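(* Let $r,s\ge1$, let $a_1,\dots,a_r,b_1,\dots,b_s,\alpha,\beta,z\in\mathbb{C}$ with $z\neq0$ satisfy the standing assumption of the context, and assume the series for ${}_rR_{s,q}={}_rR_{s,q}(a_1,\dots,a_r;b_1,\dots,b_s;\alpha,\beta;z)$ and the other series below converge absolutely. Then $$a_i\,\theta_{z,q}\,{}_rR_{s,q}=\frac{1-a_i}{1-q}\left({}_rR_{s,q}(a_iq)-{}_rR_{s,q}\right)\qquad(i=1,\dots,r),$$ and $$b_jq^{-1}\,\theta_{z,q}\,{}_rR_{s,q}=\frac{1-b_jq^{-1}}{1-q}\left({}_rR_{s,q}(b_jq^{-1})-{}_rR_{s,q}\right)\qquad(j=1,\dots,s,\ b_j\neq q).$$
   Context: Let $q\in\mathbb{C}$, $0<|q|<1$. $(a;q)_0=1$, $(a;q)_n=\prod_{i=0}^{n-1}(1-aq^i)$ for $n\ge1$, $(a;q)_\infty=\prod_{i\ge0}(1-aq^i)$. The $q$-gamma function is $\Gamma_q(x)=\frac{(q;q)_\infty}{(q^x;q)_\infty}(1-q)^{1-x}$ (principal logarithms), and $1/\Gamma_q(x)$ is read as $0$ at its poles. The basic function ${}_rR_{s,q}$ is $${}_rR_{s,q}(a_1,\dots,a_r;b_1,\dots,b_s;\alpha,\beta;z)=\sum_{\ell=0}^\infty\frac{z^\ell(-1)^{(1+s-r)\ell}q^{(1+s-r)\binom{\ell}{2}}}{(q;q)_\ell\,\Gamma_q(\ell\alpha+\beta)}\,\frac{\prod_{i=1}^r(a_i;q)_\ell}{\prod_{j=1}^s(b_j;q)_\ell}.$$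 Standing assumption: $a_iq^\ell\ne1$ and $b_jq^\ell\neq1$ for all $i,j$ and all integers $\ell\ge0$. The $q$-derivative is $(D_{z,q}f)(z)=\frac{f(z)-f(qz)}{(1-q)z}$ for $z\ne0$, and $\theta_{z,q}=zD_{z,q}$. Notation: ${}_rR_{s,q}(a_iq)$ (resp. ${}_rR_{s,q}(b_jq^{-1})$) is the same function with only $a_i$ replaced by $a_iq$ (resp. only $b_j$ by $b_jq^{-1}$). *)

(* Defs.v *)
From mathcomp Require Import all_boot all_order all_algebra.
From mathcomp Require Import all_classical all_reals all_analysis.
From mathcomp Require Export complex.

Set Implicit Arguments.
Unset Strict Implicit.
Unset Printing Implicit Defensive.

Import Order.TTheory GRing.Theory Num.Theory.
Import numFieldNormedType.Exports.

Local Open Scope ring_scope.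
Local Open Scope complex_scope.
Local Open Scope classical_set_scope.

(* The complex numbers are R[i] for R : realType. Limits are taken in R[i]^o,
   which is R[i] with the topology of its modulus. *)

Definition cexp (R : realType) (z : R[i]) : R[i] :=
  (expR (complex.Re z) * cos (complex.Im z)) +i* (expR (complex.Re z) * sin (complex.Im z)).

(* Principal argument of z != 0, in ]-pi, pi]. *)
Definition carg (R : realType) (z : R[i]) : R :=
  let t := acos (complex.Re z / complex.Re `|z|) in if 0 <= complex.Im z then t else - t.

Definition clog (R : realType) (z : R[i]) : R[i] := ln (complex.Re `|z|) +i* carg z.

(* Principal power x^y; meaningful for x != 0 only. *)
Definition cpow (R : realType) (x y : R[i]) : R[i] := cexp (y * clog x).

Definition qpoch (R : realType) (q a : R[i]) (n : nat) : R[i] :=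
  \prod_(0 <= i < n) (1 - a * q ^+ i).

Definition qpoch_infty (R : realType) (q a : R[i]) : R[i] :=
  limn (qpoch q a : nat -> R[i]^o).

(* At a pole the denominator vanishes and, since 0^-1 = 0, qGamma q x = 0;
   hence (qGamma q x)^-1 = 0 there, which is the intended value of the
   reciprocal gamma function at the poles. *)
Definition qGamma (R : realType) (q x : R[i]) : R[i] :=
  qpoch_infty q q / qpoch_infty q (cpow q x) * cpow (1 - q) (1 - x).

(* The exponent 1 + s - r is an integer, possibly negative. *)
Definition qR_term (R : realType) (q : R[i]) (r s : nat)
    (a : 'I_r -> R[i]) (b : 'I_s -> R[i]) (alpha beta z : R[i]) (l : nat) :
    R[i] :=
  let d : int := 1 + s%:Z - r%:Z in
  (z ^+ l * (-1) ^ (d * l%:Z) * q ^ (d * 'C(l, 2)%:Z))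
    / (qpoch q q l * qGamma q (l%:R * alpha + beta))
  * ((\prod_(i < r) qpoch q (a i) l) / (\prod_(j < s) qpoch q (b j) l)).

Definition qR (R : realType) (q : R[i]) (r s : nat)
    (a : 'I_r -> R[i]) (b : 'I_s -> R[i]) (alpha beta z : R[i]) : R[i] :=
  limn (series (qR_term q a b alpha beta z : nat -> R[i]^o)).

Definition abs_convergent (R : realType) (u : nat -> R[i]) : Prop :=
  cvgn [normed series (u : nat -> R[i]^o)].

(* Used for z != 0 only. *)
Definition qderiv (R : realType) (q : R[i]) (f : R[i] -> R[i]) (z : R[i]) :
    R[i] :=
  (f z - f (q * z)) / ((1 - q) * z).

Definition qtheta (R : realType) (q : R[i]) (f : R[i] -> R[i]) (z : R[i]) :
    R[i] :=
  z * qderiv q f z.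

(* Main.v *)
Require Import Defs.
From mathcomp Require Import all_boot all_order all_algebra.
From mathcomp Require Import all_classical all_reals all_analysis.
From mathcomp Require Import ring.

Import Order.TTheory GRing.Theory Num.Theory.
Import numFieldNormedType.Exports.

Local Open Scope ring_scope.
Local Open Scope complex_scope.

(** Both identities hold term by term. Write T_l(z) for the l-th term of the
    series of R(z). Passing from z to q z multiplies T_l(z) by q^l, so
    theta R is the sum of (1 - q^l) T_l(z) / (1 - q). On the other side, the
    product (a q; q)_l differs from (a; q)_l only in its extreme factors:
    [(1 - a) (a q; q)_l = (1 - a q^l) (a; q)_l] ([qpoch_shift]). Let T'_l be
    the term with a replaced by a q. Then
    [(1 - a) (T'_l - T_l) = ((1 - a q^l) - (1 - a)) T_l = a (1 - q^l) T_l],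
    which is the first identity before summation ([qR_term_contiguous_num]).
    A denominator parameter b obeys the same relation with w = b / q in place
    of a: here (w q; q)_l sits in the original series and (w; q)_l in the
    contiguous one, and both are divisors, so the ratio T'_l / T_l is again
    (1 - w q^l) / (1 - w) ([qR_term_contiguous_den]).

    Summing ([theta_contiguous]) needs the three series for R(z), R(q z) and
    the contiguous function to converge. For R(z) and the contiguous function
    this is absolute convergence, transferred to convergence in the complex
    numbers through real and imaginary parts ([abs_convergent_cvg]). For
    R(q z) it follows from the termwise identity itself, which writes
    T_l(q z) as a linear combination of T_l(z) and T'_l when w is nonzero;
    when w = 0 the identity says that T' = T, and both sides vanish. *)

Lemma normcR (R : rcfType) (x : R) : `|x%:C| = `|x|%:C :> R[i].
Proof. by rewrite normc_def /= expr0n addr0 sqrtr_sqr. Qed.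

Lemma normci (R : rcfType) : `|'i%C| = 1 :> R[i].
Proof. by rewrite normc_def /= expr0n add0r expr1n sqrtr1. Qed.

Lemma normc_ge_Im (R : rcfType) (x : R[i]) : `|complex.Im x|%:C <= `|x|.
Proof.
rewrite normc_def lecR -sqrtr_sqr ler_sqrt ?addr_ge0 ?sqr_ge0 //.
by rewrite lerDr sqr_ge0.
Qed.

Lemma cvg_Re (R : realType) (u : nat -> R[i]^o) (l : R[i]^o) :
  (u n @[n --> \oo] --> l -> complex.Re (u n) @[n --> \oo] --> complex.Re l)%classic.
Proof.
move=> /cvgrPdist_le cu; apply/cvgrPdist_le => e e0.
have eC0 : 0 < e%:C :> R[i] by rewrite ltcR.
near=> n.
rewrite -lecR -raddfB; apply: le_trans (normc_ge_Re _) _.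
by near: n; exact: cu eC0.
Unshelve. all: by end_near. Qed.

(** An error below [e] in modulus is reached by splitting [e] evenly between
    the two coordinates. A positive complex number is a positive real one,
    hence the form [e +i* 0] of the error. *)
Lemma cvg_complex (R : realType) (u v : nat -> R) (x y : R) :
  (u n @[n --> \oo] --> x -> v n @[n --> \oo] --> y ->
  (u n +i* v n : R[i]^o) @[n --> \oo] --> (x +i* y : R[i]^o))%classic.
Proof.
move=> /cvgrPdist_le cu /cvgrPdist_le cv; apply/cvgrPdist_le => -[e e'].
rewrite ltcE /= => /andP[/eqP -> e0].
have e20 : 0 < e / 2 by rewrite divr_gt0.
near=> n.
have -> : (x +i* y) - (u n +i* v n) = (x - u n)%:C + 'i%C * (y - v n)%:C :> R[i].
  by rewrite [LHS]complexE.
apply: le_trans (ler_normD _ _) _.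
have -> : e +i* 0 = (e / 2)%:C + (e / 2)%:C :> R[i].
  by rewrite -rmorphD /= -splitr.
rewrite normrM normci mul1r !normcR.
by apply: lerD; rewrite lecR; near: n; [exact: cu | exact: cv].
Unshelve. all: by end_near. Qed.

(** The sum of the moduli is a convergent series of complex numbers; its real
    part is a convergent real series, which dominates the series of real parts
    and the series of imaginary parts. These converge because the real numbers
    are complete, and the complex series is put together from them. *)
Lemma abs_convergent_cvg (R : realType) (u : nat -> R[i]) :
  abs_convergent u -> cvgn (series (u : nat -> R[i]^o)).
Proof.
move=> /cvg_ex[l] /(cvg_Re _ _ _) cl.
pose w n := complex.Re `|u n|.
have wE n : (w n)%:C = `|u n| by rewrite RRe_real // normr_real.
have cw : cvgn (series w).
  apply/cvg_ex; exists (complex.Re l); apply: cvg_trans cl.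
  apply: near_eq_cvg; near=> n.
  by rewrite /series /= raddf_sum.
have dom (f : nat -> R) : (forall n, `|f n|%:C <= `|u n|) -> cvgn (series f).
  move=> fu; have fw n : `|f n| <= w n by rewrite -lecR wE; exact: fu.
  apply: normed_cvg; apply: series_le_cvg cw => n; last exact: fw.
  - exact: normr_ge0.
  - exact: le_trans (normr_ge0 (f n)) (fw n).
have cr := dom _ (fun n => normc_ge_Re (u n)).
have ci := dom _ (fun n => normc_ge_Im _ (u n)).
apply/cvg_ex; eexists; apply: cvg_trans (cvg_complex _ _ _ _ _ cr ci).
apply: near_eq_cvg; near=> n.
rewrite /series /= [LHS]complexE /= !raddf_sum /= mulr_sumr -big_split /=.
by apply: eq_bigr => k _; rewrite [RHS]complexE.
Unshelve. all: by end_near. Qed.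

(** Both sides are the product of 1 - a q^i over 0 <= i <= l, with its first
    factor set apart on the left and its last one on the right. *)
Lemma qpoch_shift (R : realType) (q a : R[i]) (l : nat) :
  qpoch q (a * q) l * (1 - a) = qpoch q a l * (1 - a * q ^+ l).
Proof.
rewrite /qpoch -[RHS](@big_nat_recr _ _ _ l 0 (fun i => 1 - a * q ^+ i)) //.
rewrite big_nat_recl //= expr0 mulr1 mulrC; congr (_ * _).
by apply: eq_bigr => i _; rewrite exprS mulrA.
Qed.

(** Carries a relation between two shifted factorials to the products over
    all the parameters. It is free of division, so that it serves numerators
    and denominators alike. *)
Lemma prod_update (R : comNzRingType) (T : Type) (n : nat) (f : T -> R)
    (a : 'I_n -> T) (i : 'I_n) (c : T) (x y : R) :
  f c * x = f (a i) * y ->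
  (\prod_(k < n) f ([eta a with i |-> c] k)) * x = (\prod_(k < n) f (a k)) * y.
Proof.
move=> fcx; rewrite (bigD1 i) //= eqxx [in RHS](bigD1 i) //=.
rewrite (mulrAC _ _ x) (mulrAC _ _ y) fcx; congr (_ * _).
by apply: eq_bigr => k /negPf ->.
Qed.

Lemma qpoch_neq0 (R : realType) (q a : R[i]) (l : nat) :
  (forall k, a * q ^+ k != 1) -> qpoch q a l != 0.
Proof.
move=> aq.
rewrite /qpoch prodf_seq_neq0; apply/allP => k _ /=.
by rewrite subr_eq0 eq_sym aq.
Qed.

Lemma qR_term_scale (R : realType) (q : R[i]) (r s : nat)
    (a : 'I_r -> R[i]) (b : 'I_s -> R[i]) (alpha beta z : R[i]) (l : nat) :
  qR_term q a b alpha beta (q * z) l = q ^+ l * qR_term q a b alpha beta z l.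
Proof. by rewrite /qR_term exprMn -!mulrA. Qed.

(** By [qpoch_shift], (1 - a_i) times the contiguous term is (1 - a_i q^l)
    times the original one. *)
Lemma qR_term_contiguous_num (R : realType) (q : R[i]) (r s : nat)
    (a : 'I_r -> R[i]) (b : 'I_s -> R[i]) (alpha beta z : R[i])
    (i : 'I_r) (l : nat) :
  a i * (qR_term q a b alpha beta z l - qR_term q a b alpha beta (q * z) l)
  = (1 - a i) * (qR_term q [eta a with i |-> a i * q] b alpha beta z l
                 - qR_term q a b alpha beta z l).
Proof.
rewrite qR_term_scale /qR_term.
have := @prod_update _ _ _ ((qpoch q)^~ l) a i _ _ _ (qpoch_shift _ q (a i) l).
set A' := \prod_(k < r) _; set A := \prod_(k < r) _.
set K := _ / (qpoch q q l * _); set B := \prod_(j < s) _ => AA.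
have -> : (1 - a i) * (K * (A' / B) - K * (A / B))
  = K / B * (A' * (1 - a i)) - (1 - a i) * K * (A / B) by ring.
by rewrite AA; ring.
Qed.

(** [qpoch_shift] is used at w = b_j / q. Clearing denominators requires that
    no w q^k equals 1: for k > 0 this is the hypothesis on b_j q^(k-1), and
    for k = 0 it is b_j <> q. *)
Lemma qR_term_contiguous_den (R : realType) (q : R[i]) (r s : nat)
    (a : 'I_r -> R[i]) (b : 'I_s -> R[i]) (alpha beta z : R[i])
    (j : 'I_s) (l : nat) :
  q != 0 -> b j != q -> (forall k m, b k * q ^+ m != 1) ->
  b j * q^-1 * (qR_term q a b alpha beta z l - qR_term q a b alpha beta (q * z) l)
  = (1 - b j * q^-1) *
    (qR_term q a [eta b with j |-> b j * q^-1] alpha beta z l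
     - qR_term q a b alpha beta z l).
Proof.
move=> q0 bq hb; set w := b j * q^-1.
have w1 : 1 - w != 0.
  rewrite subr_eq0 eq_sym; apply: contra bq => /eqP wE.
  by rewrite -(divfK q0 (b j)) -/w [w]wE mul1r.
have hw k : w * q ^+ k != 1.
  case: k => [|k]; first by rewrite mulr1 eq_sym -subr_eq0.
  by rewrite exprS /w -mulrA mulKf.
rewrite qR_term_scale /qR_term.
have wb : w * q = b j by rewrite divfK.
have := qpoch_shift _ q w l; rewrite wb => /esym bs.
have B0 : \prod_(k < s) qpoch q (b k) l != 0.
  by apply/prodf_neq0 => k _; exact: qpoch_neq0.
have B'0 : \prod_(k < s) qpoch q ([eta b with j |-> w] k) l != 0.
  by apply/prodf_neq0 => k _ /=; case: ifP => _; exact: qpoch_neq0.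
move: B0 B'0; set B := \prod_(k < s) qpoch q (b k) l.
set B' := \prod_(k < s) _ => B0 B'0.
have BB : B' * (1 - w * q ^+ l) = B * (1 - w).
  exact: (@prod_update _ _ _ ((qpoch q)^~ l) b j w _ _ bs).
set K := _ / (qpoch q q l * _); set A := \prod_(k < r) _.
have -> : A / B' = A / B * ((1 - w * q ^+ l) / (1 - w)).
  have -> : 1 - w * q ^+ l = B * (1 - w) / B'.
    by apply: (canRL (mulfK B'0)); rewrite mulrC.
  by field; rewrite w1 B0 B'0.
by field; rewrite B0 w1.
Qed.

Definition csum (R : realType) (u : nat -> R[i]) : R[i] :=
  limn (series (u : nat -> R[i]^o)).

(** The common summation step of both identities: [w] is the numerator
    parameter [a i], respectively [b j / q], and [g] the sequence of terms of
    the contiguous function. Convergence of the series at [q * z] is derived,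
    by solving the termwise relation for [f (q * z) l]. *)
Lemma theta_contiguous (R : realType) (q w z : R[i]) (f : R[i] -> nat -> R[i])
    (g : nat -> R[i]) :
  q != 1 -> z != 0 -> abs_convergent (f z) -> abs_convergent g ->
  (forall l, w * (f z l - f (q * z) l) = (1 - w) * (g l - f z l)) ->
  w * qtheta q (fun x => csum _ (f x)) z
  = (1 - w) / (1 - q) * (csum _ g - csum _ (f z)).
Proof.
move=> q1 z0 /(abs_convergent_cvg _ _) cf /(abs_convergent_cvg _ _) cg fg.
suff main : w * (csum _ (f z) - csum _ (f (q * z)))
            = (1 - w) * (csum _ g - csum _ (f z)).
  have q10 : 1 - q != 0 by rewrite subr_eq0 eq_sym.
  rewrite /qtheta /qderiv [RHS]mulrAC -main.
  by field; rewrite q10 z0.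
have [w0|w0] := eqVneq w 0.
  (* Here [fg] forces [g = f z]; it leaves [f (q * z)] undetermined, but its
     coefficient [w] vanishes. *)
  rewrite w0 mul0r subr0 mul1r; apply/esym/eqP; rewrite subr_eq0; apply/eqP.
  congr (csum _ _); apply/funext => l.
  by move/eqP: (fg l); rewrite w0 mul0r subr0 mul1r eq_sym subr_eq0 => /eqP.
pose k := (1 - w) / w.
have wk : w * k = 1 - w by rewrite /k mulrC divfK.
have fqz l : f (q * z) l = f z l - k * (g l - f z l).
  by apply: (mulfI w0); rewrite mulrBr mulrA wk -fg; ring.
have -> : csum _ (f (q * z)) = csum _ (f z) - k * (csum _ g - csum _ (f z)).
  apply: (@cvg_lim R[i]^o); first exact: norm_hausdorff.
  apply: cvg_trans (cvgB cf (cvgZl_tmp (k := k) (cvgB cg cf))).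
  apply: near_eq_cvg; near=> n.
  rewrite /series /= !fctE /= /GRing.scale /= -!sumrB mulr_sumr -sumrB.
  by apply: eq_bigr => l _; rewrite fqz.
by rewrite -wk; ring.
Unshelve. all: by end_near. Qed.

Theorem theorem7 (R : realType) (q : R[i]) (r s : nat)
    (a : 'I_r -> R[i]) (b : 'I_s -> R[i]) (alpha beta z : R[i]) :
  0 < `|q| < 1 ->
  (1 <= r)%N -> (1 <= s)%N ->
  z != 0 ->
  (forall (i : 'I_r) (l : nat), a i * q ^+ l != 1) ->
  (forall (j : 'I_s) (l : nat), b j * q ^+ l != 1) ->
  abs_convergent (qR_term q a b alpha beta z) ->
  (forall i : 'I_r,
     abs_convergent (qR_term q [eta a with i |-> a i * q] b alpha beta z)) ->
  (forall j : 'I_s, b j != q ->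
     abs_convergent (qR_term q a [eta b with j |-> b j * q^-1] alpha beta z)) ->
  (forall i : 'I_r,
     a i * qtheta q (qR q a b alpha beta) z
     = (1 - a i) / (1 - q)
       * (qR q [eta a with i |-> a i * q] b alpha beta z
          - qR q a b alpha beta z))
  /\
  (forall j : 'I_s, b j != q ->
     b j * q^-1 * qtheta q (qR q a b alpha beta) z
     = (1 - b j * q^-1) / (1 - q)
       * (qR q a [eta b with j |-> b j * q^-1] alpha beta z
          - qR q a b alpha beta z)).
Proof.
move=> /andP[q_gt0 q_lt1] _ _ z0 _ hb cT cTa cTb.
have q0 : q != 0 by rewrite -normr_gt0.
have q1 : q != 1 by apply: contraTneq q_lt1 => ->; rewrite normr1 ltxx.
split=> [i|j bq].
- exact: (theta_contiguous _ _ _ _ (qR_term q a b alpha beta) _ q1 z0 cT (cTa i)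
    (qR_term_contiguous_num _ _ _ _ _ _ _ _ _ i)).
- apply: (theta_contiguous _ _ _ _ (qR_term q a b alpha beta) _ q1 z0 cT
    (cTb j bq)) => l.
  exact: qR_term_contiguous_den.
Qed.
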